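(* Let $M_b \in \{0,1\}^{m\times n}$ be the adjacency matrix of an (unweighted) bipartite graph $G_b=(V_1\cup V_2,E)$ in which every vertex is connected to at least one other vertex, and for $d>0$ let $M_d=(1+d)M_b-d\,\mathbf{1}_{m\times n}$. If $d\ge\sqrt{|E|}$, then any optimal solution $(v,w)$ of $$\text{(NF-1d)}\qquad \min_{v\in\mathbb{R}^m,\;w\in\mathbb{R}^n}\ \|M_d-vw\|_F^2\quad\text{such that } v\ge\mathbf 0,\ w\ge \mathbf 0$$ coincides with an optimal solution of $$\text{(MBP)}\qquad \min_{v,w}\ \|M_b-vw\|_F^2\quad\text{such that } v\in\{0,1\}^m,\ w\in\{0,1\}^n,\ v_iw_j\le M_b(i,j)\ \ \forall i,j;$$ i.e. $vw$ is binary and $vw\le M_b$ (entrywise), and there is an optimal solution $(v',w')$ of (MBP) with $vw=v'w'$.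
   Context: $v$ is a column vector of length $m$ and $w$ a row vector of length $n$, so $vw$ is an $m\times n$ matrix. $M_b(i,j)=1$ if and only if the $i$-th vertex of $V_1$ and the $j$-th vertex of $V_2$ are joined by an edge; $|E|$ is the number of edges, so $|E|=\|M_b\|_F^2$. The assumption on vertices means that no row and no column of $M_b$ is zero. $\mathbf{1}_{m\times n}$ is the all-ones matrix, so $M_d$ is $M_b$ with its zero entries replaced by $-d$. A solution $(v,w)$ coincides with a solution $(v',w')$ if and only if $vw=v'w'$. Problem (MBP) is the maximum edge biclique problem: its feasible solutions correspond to bicliques of $G_b$, and its objective is equivalent to maximizing $\sum_{i,j}v_iw_j$. *)

(* Defs.v *)
From mathcomp Require Import all_boot all_order all_algebra.
From mathcomp Require Import reals.

Set Implicit Arguments.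
Unset Strict Implicit.
Unset Printing Implicit Defensive.

Import Order.TTheory GRing.Theory Num.Theory.
Local Open Scope ring_scope.

(* A bipartite graph with parts V1 = 'I_m and V2 = 'I_n is given by its edge
   set E : {set 'I_m * 'I_n}. *)

Definition no_isolated_vertex (m n : nat) (E : {set 'I_m * 'I_n}) : Prop :=
  (forall i : 'I_m, exists j : 'I_n, (i, j) \in E) /\
  (forall j : 'I_n, exists i : 'I_m, (i, j) \in E).

Definition biadj (R : realType) (m n : nat) (E : {set 'I_m * 'I_n})
    : 'M[R]_(m, n) :=
  \matrix_(i, j) (if (i, j) \in E then 1 else 0).

Definition penalized (R : realType) (m n : nat) (d : R) (Mb : 'M[R]_(m, n))
    : 'M[R]_(m, n) :=
  (1 + d) *: Mb - d *: const_mx 1.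

Definition frobenius_norm (R : realType) (m n : nat) (A : 'M[R]_(m, n)) : R :=
  Num.sqrt (\sum_i \sum_j A i j ^+ 2).

Definition nonneg_mx (R : realType) (m n : nat) (A : 'M[R]_(m, n)) : Prop :=
  forall i j, 0 <= A i j.

Definition binary_mx (R : realType) (m n : nat) (A : 'M[R]_(m, n)) : Prop :=
  forall i j, A i j = 0 \/ A i j = 1.

Definition entrywise_le (R : realType) (m n : nat) (A B : 'M[R]_(m, n)) : Prop :=
  forall i j, A i j <= B i j.

Definition rank1_error (R : realType) (m n : nat) (A : 'M[R]_(m, n))
    (v : 'cV[R]_m) (w : 'rV[R]_n) : R :=
  frobenius_norm (A - v *m w) ^+ 2.

Definition optimal (R : realType) (m n : nat)
    (feasible : 'cV[R]_m -> 'rV[R]_n -> Prop)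
    (objective : 'cV[R]_m -> 'rV[R]_n -> R)
    (v : 'cV[R]_m) (w : 'rV[R]_n) : Prop :=
  feasible v w /\
  forall v' w', feasible v' w' -> objective v w <= objective v' w'.

Definition NF1d_optimal (R : realType) (m n : nat) (E : {set 'I_m * 'I_n})
    (d : R) : 'cV[R]_m -> 'rV[R]_n -> Prop :=
  optimal (fun v w => nonneg_mx v /\ nonneg_mx w)
          (rank1_error (penalized d (biadj R E))).

Definition MBP_optimal (R : realType) (m n : nat) (E : {set 'I_m * 'I_n})
    : 'cV[R]_m -> 'rV[R]_n -> Prop :=
  optimal (fun v w => [/\ binary_mx v, binary_mx w &
             forall i j, v i 0 * w 0 j <= biadj R E i j])
          (rank1_error (biadj R E)).

(* Main.v *)
Require Import Defs.
From mathcomp Require Import all_boot all_order all_algebra.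
From mathcomp Require Import reals.
From mathcomp Require Import ring lra.

(** Let [(v, w)] be optimal for (NF-1d) and [X = vw]. Stationarity gives
    [<M_d, X> = |X|^2 = |v|^2 |w|^2], whence [|v|^2 |w|^2 <= |E| <= d^2]. If
    [v_i w_j > 0] at a non-edge [(i, j)], the second variation of the error in
    the direction [(e_i, - c e_j)] is
    [|w|^2 + c^2 |v|^2 - 2 c d - 4 c v_i w_j], which is negative for
    [c = d / |v|^2], contradicting optimality. Hence the support of [X] is a
    biclique, on which [M_d] is all ones, and stationarity forces [X = 1] there.
    Finally, on binary [X <= M_b] the errors to [M_b] and to [M_d] differ by a
    constant, so [X] is also optimal for (MBP). *)

Set Implicit Arguments.
Unset Strict Implicit.
Unset Printing Implicit Defensive.

Import Order.TTheory GRing.Theory Num.Theory.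
Local Open Scope ring_scope.

(** * Auxiliary facts on polynomials and sums *)

Lemma poly3_constant_coef_ge0 (R : realFieldType) (eps h k l p : R) :
  0 < eps ->
  (forall t, 0 < t -> t <= eps ->
     0 <= h + t * k + t ^+ 2 * l + t ^+ 3 * p) ->
  0 <= h.
Proof.
move=> eps0 H; rewrite leNgt; apply/negP => h0.
pose D := 1 + (`|k| + `|l| + `|p|).
have D0 : 0 < D by rewrite ltr_wpDr // !addr_ge0.
(* The bound [1] reduces every power of [t] to [t] itself; the bound [- h / D] makes the remaining
   terms at most [- h - t], the strict gap [t] coming from the summand [1] in [D]. *)
pose t := Num.min (Num.min eps 1) (- h / D).
have q0 : 0 < - h / D by rewrite divr_gt0 ?oppr_gt0.
have t0 : 0 < t by rewrite !lt_min eps0 ltr01 q0.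
have te : t <= eps by rewrite !ge_min lexx.
have t1 : t <= 1 by rewrite !ge_min lexx orbT.
have tq : t * D <= - h.
  by rewrite -ler_pdivlMr // ge_min lexx orbT.
have term n (x : R) : t ^+ n.+1 * x <= t * `|x|.
  apply: (@le_trans _ _ (t ^+ n.+1 * `|x|)).
    by rewrite ler_pM2l ?exprn_gt0 // ler_norm.
  by rewrite ler_wpM2r // exprS ger_pMr // exprn_ile1 // ltW.
have := H t t0 te; have := term 0 k; have := term 1 l; have := term 2 p.
rewrite expr1; move: tq; rewrite /D !mulrDr mulr1.
lra.
Qed.

Lemma sum_delta (R : pzSemiRingType) (I : finType) (i : I) (F : I -> R) :
  \sum_k (k == i)%:R * F k = F i.
Proof.
rewrite (bigD1 i) //= eqxx mul1r big1 ?addr0 // => k /negPf ->.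
by rewrite mul0r.
Qed.

(** * Squared Frobenius error of a rank-one approximation *)

Definition err (R : pzRingType) (I J : finType) (A : I -> J -> R) (v : I -> R)
    (w : J -> R) : R :=
  \sum_i \sum_j (A i j - v i * w j) ^+ 2.

(** Optimality for (NF-1d), with functions on finite types in place of matrices, so that exchanging
    rows and columns only swaps arguments. *)
Definition nonneg_optimal (R : numDomainType) (I J : finType)
    (A : I -> J -> R) (v : I -> R) (w : J -> R) : Prop :=
  [/\ forall i, 0 <= v i, forall j, 0 <= w j &
    forall v' w', (forall i, 0 <= v' i) -> (forall j, 0 <= w' j) ->
      err A v w <= err A v' w'].

Lemma err_tr (R : comPzRingType) (I J : finType) (A : I -> J -> R) v w :
  err (fun j i => A i j) w v = err A v w.
Proof.
rewrite /err exchange_big; apply: eq_bigr => i _; apply: eq_bigr => j _.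
by rewrite [w j * _]mulrC.
Qed.

Lemma nonneg_optimal_tr (R : numDomainType) (I J : finType)
    (A : I -> J -> R) v w :
  nonneg_optimal A v w -> nonneg_optimal (fun j i => A i j) w v.
Proof.
case=> v0 w0 H; split=> // w' v' w'0 v'0.
by rewrite (err_tr A v w) -(err_tr _ w' v'); apply: H.
Qed.

(** Grouping by powers of [t] exposes the first and second variations in the direction [(x, y)] as
    the coefficients of [t] and [t ^+ 2]. *)
Lemma err_expand (R : comPzRingType) (I J : finType) (A : I -> J -> R)
    v w x y t :
  err A (fun i => v i + t * x i) (fun j => w j + t * y j) =
  err A v w
  - t * (2 * \sum_i \sum_j (A i j - v i * w j) * (x i * w j + v i * y j))
  + t ^+ 2 * (\sum_i \sum_j ((x i * w j + v i * y j) ^+ 2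
                             - 2 * (A i j - v i * w j) * (x i * y j)))
  + t ^+ 3 * (2 * \sum_i \sum_j (x i * w j + v i * y j) * (x i * y j))
  + t ^+ 4 * \sum_i \sum_j (x i * y j) ^+ 2.
Proof.
rewrite /err !mulrA !mulr_sumr -sumrN -!big_split /=; apply: eq_bigr => i _.
rewrite !mulr_sumr -sumrN -!big_split /=; apply: eq_bigr => j _; ring.
Qed.

(** * First- and second-order optimality conditions *)

Section Optimality.

Variables (R : realFieldType) (I J : finType) (A : I -> J -> R).
Variables (v : I -> R) (w : J -> R).
Hypothesis vw_opt : nonneg_optimal A v w.

Let r i j := A i j - v i * w j.

(** Along a feasible direction the increase of the error is [t] times a cubic with constant
    coefficient [- (2 * g)], so this coefficient is nonnegative. If [g = 0], a second factor [t]
    splits off and the second variation becomes the constant coefficient. *)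
Lemma variation_ge0 (x : I -> R) (y : J -> R) (eps : R) :
  0 < eps ->
  (forall t i, 0 < t -> t <= eps -> 0 <= v i + t * x i) ->
  (forall t j, 0 < t -> t <= eps -> 0 <= w j + t * y j) ->
  let g := \sum_i \sum_j r i j * (x i * w j + v i * y j) in
  g <= 0 /\
  (g = 0 -> 0 <= \sum_i \sum_j ((x i * w j + v i * y j) ^+ 2
                                 - 2 * r i j * (x i * y j))).
Proof.
move=> eps0 vx wy g; case: vw_opt => _ _ H.
set h := \sum_i _.
pose k := 2 * \sum_i \sum_j (x i * w j + v i * y j) * (x i * y j).
pose l := \sum_i \sum_j (x i * y j) ^+ 2.
have E t : 0 < t -> t <= eps ->
    0 <= t * (- (2 * g) + t * h + t ^+ 2 * k + t ^+ 3 * l).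
  move=> t0 te.
  have := H _ _ (fun i => vx t i t0 te) (fun j => wy t j t0 te).
  rewrite err_expand -subr_ge0; congr (0 <= _).
  rewrite -/g -/h -/k -/l; ring.
split=> [|g0].
  suff : 0 <= - (2 * g) by lra.
  apply: (poly3_constant_coef_ge0 eps0) => t t0 te.
  by rewrite -(pmulr_rge0 _ t0); apply: E.
apply: (poly3_constant_coef_ge0 (k := k) (l := l) (p := 0) eps0) => t t0 te.
rewrite -(pmulr_rge0 _ t0) -(pmulr_rge0 _ t0).
have := E t t0 te; rewrite g0; congr (0 <= _); ring.
Qed.

Lemma row_stationary i : 0 < v i -> \sum_j r i j * w j = 0.
Proof.
case: vw_opt => v0 w0 _ vi0.
(* A positive [v i] can be moved both ways: the direction [s] times the [i]-th unit vector is
   feasible for steps up to [v i], and [s = 1], [s = -1] give the two inequalities. *)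
have sgn s : `|s| = 1 -> s * (\sum_j r i j * w j) <= 0.
  move=> s1.
  have [] := @variation_ge0 (fun k => (k == i)%:R * s) (fun=> 0) (v i) vi0.
  - move=> t k t0 tv; have [->|_] := eqVneq k i; last first.
      by rewrite mul0r mulr0 addr0.
    rewrite mul1r -lerBlDr sub0r.
    apply: le_trans tv; rewrite -mulrN ger_pMr //.
    by rewrite -s1 -normrN ler_norm.
  - by move=> t j _ _; rewrite mulr0 addr0.
  move=> + _; congr (_ <= 0).
  rewrite -(sum_delta i (fun k => s * \sum_j r k j * w j)).
  apply: eq_bigr => k _; rewrite !mulr_sumr; apply: eq_bigr => j _; ring.
have := sgn 1 (normr1 _); have := sgn (-1) (normrN1 _).
by rewrite mulN1r mul1r oppr_le0 => ? ?; apply/eqP; rewrite eq_le; apply/andP.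
Qed.

End Optimality.

(** Row stationarity multiplied by [v i] and summed over [i]; rows with [v i = 0] contribute nothing
    to either side. *)
Lemma stationary_inner_product (R : realFieldType) (I J : finType) (A : I -> J -> R)
    v w :
  nonneg_optimal A v w ->
  \sum_i \sum_j A i j * (v i * w j) =
  (\sum_i v i ^+ 2) * (\sum_j w j ^+ 2).
Proof.
move=> opt; have [v0 w0 _] := opt.
rewrite mulr_suml; apply: eq_bigr => i _.
have [-> | vi] := eqVneq (v i) 0.
  by rewrite expr0n mul0r big1 // => j _; rewrite mul0r mulr0.
have vi0 : 0 < v i by rewrite lt_neqAle eq_sym vi v0.
have := congr1 ( *%R (v i)) (row_stationary opt vi0).
rewrite mulr0 => E; apply: subr0_eq.
rewrite -[RHS]E !mulr_sumr -sumrB; apply: eq_bigr => j _; ring.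
Qed.

Lemma second_variation_ge0 (R : realFieldType) (I J : finType) (A : I -> J -> R)
    v w i j c :
  nonneg_optimal A v w -> 0 < v i -> 0 < w j -> 0 < c ->
  0 <= \sum_k w k ^+ 2 + c ^+ 2 * \sum_k v k ^+ 2
       + 2 * c * (A i j - 2 * (v i * w j)).
Proof.
move=> opt vi wj c0; have [v0 w0 _] := opt.
(* Raise [v i] at rate 1 and lower [w j] at rate [c]; [w j / c] is the last step at which the latter
   stays nonnegative. *)
have [] := variation_ge0 (x := fun k => (k == i)%:R)
  (y := fun k => (k == j)%:R * - c) (eps := w j / c) opt.
- by rewrite divr_gt0.
- by move=> t k t0 _; rewrite addr_ge0 // mulr_ge0 ?ler0n // ltW.
- move=> t k t0; rewrite ler_pdivlMr // => tw.
  have [->|_] := eqVneq k j; last by rewrite mul0r mulr0 addr0.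
  by rewrite mul1r mulrN subr_ge0.
move=> _ H.
have row := row_stationary opt vi.
have col := row_stationary (nonneg_optimal_tr opt) wj.
(* The first variation is row stationarity at [i] minus [c] times column stationarity at [j], so the
   second-order condition applies. *)
have g0 : \sum_i0 \sum_j0 (A i0 j0 - v i0 * w j0) *
    ((i0 == i)%:R * w j0 + v i0 * ((j0 == j)%:R * - c)) = 0.
  transitivity (\sum_k (k == i)%:R * (\sum_l (A k l - v k * w l) * w l)
    - c * \sum_l (l == j)%:R * (\sum_k (A k l - w l * v k) * v k)).
    rewrite mulr_sumr.
    under [X in _ = _ - X]eq_bigr do rewrite !mulr_sumr.
    rewrite [X in _ = _ - X]exchange_big -sumrB /=; apply: eq_bigr => k _.
    rewrite mulr_sumr -sumrB; apply: eq_bigr => l _; ring.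
  by rewrite !sum_delta row col mulr0 subr0.
have := H g0; congr (0 <= _).
rewrite -(sum_delta i (fun=> \sum_k w k ^+ 2)) -(sum_delta j (fun=> _ * _)).
(* At [(i, j)] the cross term of the square, [- 2 * c * (v i * w j)], joins the residual term
   [2 * c * (A i j - v i * w j)]; hence the factor 2 in front of [v i * w j]. *)
transitivity (\sum_k \sum_l ((k == i)%:R * w l ^+ 2
   + (l == j)%:R * (c ^+ 2 * v k ^+ 2)
   + (k == i)%:R * ((l == j)%:R * (2 * c * (A k l - 2 * (v k * w l)))))).
  apply: eq_bigr => k _; apply: eq_bigr => l _.
  by case: (k == i); case: (l == j); rewrite /=; ring.
transitivity (\sum_k (k == i)%:R * (\sum_l w l ^+ 2)
  + c ^+ 2 * (\sum_k v k ^+ 2 * (\sum_l (l == j)%:R * 1))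
  + \sum_k (k == i)%:R *
      (\sum_l (l == j)%:R * (2 * c * (A k l - 2 * (v k * w l))))).
  rewrite mulr_sumr -!big_split; apply: eq_bigr => k _ /=.
  rewrite !mulr_sumr -!big_split; apply: eq_bigr => l _ /=; ring.
by rewrite !sum_delta; under [X in _ + _ * X + _]eq_bigr do rewrite mulr1.
Qed.

(** * Support and values of an optimum of the penalized problem *)

Section PenalizedGraph.

Variables (R : realFieldType) (I J : finType) (E : {set I * J}) (d : R).
Hypotheses (d_gt0 : 0 < d) (leEd : #|E|%:R <= d ^+ 2).

Let A i j : R := if (i, j) \in E then 1 else - d.

Variables (v : I -> R) (w : J -> R).
Hypothesis vw_opt : nonneg_optimal A v w.

(** With [X = v i * w j], each entry satisfies [2 * A i j * X <= 1 + X ^+ 2] on edges, by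
    [(1 - X) ^+ 2 >= 0], and [2 * A i j * X <= X ^+ 2] off them. By stationarity the sum of the left
    sides is twice that of the [X ^+ 2]. *)
Let sqr_norm_mul_le :
  (\sum_i v i ^+ 2) * (\sum_j w j ^+ 2) <= #|E|%:R.
Proof.
have [v0 w0 _] := vw_opt.
have cardE : #|E|%:R = \sum_i \sum_j ((i, j) \in E)%:R :> R.
  rewrite pair_big /= -sum1_card natr_sum big_mkcond /=.
  by apply: eq_bigr => -[i j] _ /=; case: ifP.
have sqr : (\sum_i v i ^+ 2) * (\sum_j w j ^+ 2) =
    \sum_i \sum_j (v i * w j) ^+ 2.
  rewrite mulr_suml; apply: eq_bigr => i _; rewrite mulr_sumr.
  by apply: eq_bigr => j _; rewrite exprMn.
have : 2 * (\sum_i \sum_j A i j * (v i * w j)) <=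
    #|E|%:R + \sum_i \sum_j (v i * w j) ^+ 2.
  rewrite cardE mulr_sumr -big_split; apply: ler_sum => i _ /=.
  rewrite mulr_sumr -big_split; apply: ler_sum => j _ /=.
  have X0 : 0 <= v i * w j by rewrite mulr_ge0.
  rewrite /A; case: ifP => _ /=.
    rewrite mul1r -subr_ge0; have := sqr_ge0 (1 - v i * w j).
    by congr (0 <= _); ring.
  have := sqr_ge0 (v i * w j); have := mulr_ge0 (ltW d_gt0) X0.
  rewrite mulNr; lra.
rewrite (stationary_inner_product vw_opt) -sqr; lra.
Qed.

Lemma support_in_edges i j : 0 < v i -> 0 < w j -> (i, j) \in E.
Proof.
move=> vi wj; apply/negP => /negP ijE.
have a0 : 0 < \sum_k v k ^+ 2.
  rewrite (bigD1 i) //= ltr_wpDr ?exprn_gt0 //.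
  by apply: sumr_ge0 => k _; apply: sqr_ge0.
(* The choice [c = d / a] minimizes [c ^+ 2 * a - 2 * c * d]. Multiplied by [a], the second
   variation is [a * b - d ^+ 2 - 4 * d * (v i * w j)], negative since [a * b <= d ^+ 2]. *)
have := second_variation_ge0 vw_opt vi wj (divr_gt0 d_gt0 a0).
have X0 : 0 < v i * w j by rewrite mulr_gt0.
move: a0 sqr_norm_mul_le.
set a := \sum_k v k ^+ 2; set b := \sum_k w k ^+ 2 => a0 ab.
rewrite /A (negPf ijE) -(pmulr_rge0 _ a0).
have -> : a * (b + (d / a) ^+ 2 * a + 2 * (d / a) * (- d - 2 * (v i * w j))) =
    a * b - d ^+ 2 - 4 * (d * (v i * w j)).
  by field; rewrite gt_eqF.
have := mulr_gt0 d_gt0 X0.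
have := le_trans ab leEd.
lra.
Qed.

(** Row stationarity, where [A i j = 1] whenever [w j > 0], and the other terms vanish. *)
Lemma row_sum_supported i : 0 < v i -> \sum_j w j = v i * \sum_j w j ^+ 2.
Proof.
move=> vi; have [_ w0 _] := vw_opt.
rewrite mulr_sumr; apply: subr0_eq.
rewrite -[RHS](row_stationary vw_opt vi) -sumrB; apply: eq_bigr => j _.
have [->|wj] := eqVneq (w j) 0; first by rewrite expr0n !mulr0 subrr.
rewrite /A support_in_edges //; first by ring.
by rewrite lt_neqAle eq_sym wj w0.
Qed.

End PenalizedGraph.

(** The row identities force all positive [v k] to be equal, so the squared norm of [v] is [v i]
    times its sum. The column identity at [j] then reads [\sum_k v k = w j * v i * \sum_k v k], and
    the positive sum cancels. *)
Lemma penalized_optimal_binary (R : realFieldType) (I J : finType)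
    (E : {set I * J}) (d : R) (v : I -> R) (w : J -> R) i j :
  0 < d -> #|E|%:R <= d ^+ 2 ->
  nonneg_optimal (fun i j => if (i, j) \in E then 1 else - d) v w ->
  0 < v i -> 0 < w j -> v i * w j = 1.
Proof.
move=> d0 leEd opt vi wj; have [v0 w0 _] := opt.
(* The graph with its two parts exchanged, on which the row identity yields the column identity. *)
pose E' := [set p : J * I | (p.2, p.1) \in E].
have leE'd : #|E'|%:R <= d ^+ 2.
  suff -> : #|E'| = #|E| by [].
  have -> : E' = [set (p.2, p.1) | p in E].
    apply/setP => -[l k]; rewrite inE /=; apply/idP/imsetP.
      by move=> kl; exists (k, l).
    by case=> -[k' l'] kl [-> ->].
  by apply: card_imset => -[? ?] [? ?] [-> ->].
have opt' : nonneg_optimal (fun j i => if (j, i) \in E' then 1 else - d) w v.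
  have [_ _ H] := nonneg_optimal_tr opt.
  split=> // w' v' w'0 v'0; have := H w' v' w'0 v'0; rewrite /err.
  by congr (_ <= _); apply: eq_bigr => l _; apply: eq_bigr => k _; rewrite inE.
have row k := row_sum_supported d0 leEd opt (i := k).
have col := row_sum_supported d0 leE'd opt' wj.
have b0 : 0 < \sum_k w k ^+ 2.
  rewrite (bigD1 j) //= ltr_wpDr ?exprn_gt0 //.
  by apply: sumr_ge0 => k _; apply: sqr_ge0.
have vE k : v k ^+ 2 = v i * v k.
  have [->|vk] := eqVneq (v k) 0; first by rewrite expr0n mulr0.
  have vk0 : 0 < v k by rewrite lt_neqAle eq_sym vk v0.
  suff -> : v i = v k by [].
  by apply: (mulIf (lt0r_neq0 b0)); rewrite -!row.
have V0 : 0 < \sum_k v k.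
  by rewrite (bigD1 i) //= ltr_wpDr // sumr_ge0.
apply: (mulIf (lt0r_neq0 V0)); rewrite mul1r {2}col mulrC.
under [in RHS]eq_bigr do rewrite vE.
by rewrite -mulr_sumr; ring.
Qed.

(** * Return to matrices and to (MBP) *)

Lemma rank1_errorE (R : realType) (m n : nat) (A : 'M[R]_(m, n)) v w :
  rank1_error A v w = err A (fun i => v i 0) (fun j => w 0 j).
Proof.
rewrite /rank1_error /frobenius_norm sqr_sqrtr.
  rewrite /err; apply: eq_bigr => i _; apply: eq_bigr => j _.
  by rewrite !mxE big_ord1.
by apply: sumr_ge0 => i _; apply: sumr_ge0 => j _; apply: sqr_ge0.
Qed.

Lemma penalizedE (R : realType) (m n : nat) (E : {set 'I_m * 'I_n}) (d : R) i j :
  penalized d (biadj R E) i j = if (i, j) \in E then 1 else - d.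
Proof. by rewrite !mxE; case: ifP => _; ring. Qed.

(** On edges the two matrices agree; off edges feasibility forces the binary product to be 0,
    leaving only a square of the matrix entry, independent of [v] and [w]. *)
Lemma rank1_error_biadj (R : realType) (m n : nat) (E : {set 'I_m * 'I_n})
    (d : R) v w :
  binary_mx v -> binary_mx w ->
  (forall i j, v i 0 * w 0 j <= biadj R E i j) ->
  rank1_error (biadj R E) v w = rank1_error (penalized d (biadj R E)) v w +
    \sum_i \sum_j (biadj R E i j ^+ 2 - penalized d (biadj R E) i j ^+ 2).
Proof.
move=> bv bw le; rewrite !rank1_errorE /err -big_split.
apply: eq_bigr => i _; rewrite -big_split; apply: eq_bigr => j _ /=.
have := le i j; rewrite penalizedE mxE.
case: ifP => _; first by move=> _; ring.
case: (bv i 0) => ->; first by move=> _; ring.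
case: (bw 0 j) => ->; first by move=> _; ring.
by rewrite mulr1 ler10.
Qed.

Theorem theorem4 (R : realType) (m n : nat) (E : {set 'I_m * 'I_n}) (d : R)
    (hE : no_isolated_vertex E) (d_gt0 : 0 < d)
    (hd : Num.sqrt (#|E|%:R) <= d)
    (v : 'cV[R]_m) (w : 'rV[R]_n) (hvw : NF1d_optimal E d v w) :
  [/\ binary_mx (v *m w),
      entrywise_le (v *m w) (biadj R E) &
      exists (v' : 'cV[R]_m) (w' : 'rV[R]_n),
        MBP_optimal E v' w' /\ v *m w = v' *m w'].
Proof.
have leEd : #|E|%:R <= d ^+ 2.
  by rewrite -(sqr_sqrtr (ler0n R #|E|)) ler_sqr ?nnegrE ?sqrtr_ge0 // ltW.
have [[v0 w0] opt] := hvw.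
have nopt : nonneg_optimal (fun i j => if (i, j) \in E then 1 else - d)
    (fun i => v i 0) (fun j => w 0 j).
  split=> // v' w' v'0 w'0.
  have := opt (\col_i v' i) (\row_j w' j).
  rewrite !rank1_errorE /err.
  have feas : nonneg_mx (\col_i v' i) /\ nonneg_mx (\row_j w' j).
    by split=> i j; rewrite mxE.
  move=> /(_ feas); congr (_ <= _); apply: eq_bigr => i _;
    by apply: eq_bigr => j _; rewrite penalizedE ?mxE.
(* Indicators of the supports: [v] and [w] themselves need not be binary, as they may be rescaled by
   inverse factors. *)
pose v' : 'cV[R]_m := \col_i (0 < v i 0)%R%:R.
pose w' : 'rV[R]_n := \row_j (0 < w 0 j)%R%:R.
have bv' : binary_mx v' by move=> i j; rewrite mxE; case: ltP; [right | left].
have bw' : binary_mx w' by move=> i j; rewrite mxE; case: ltP; [right | left].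
have vw : v *m w = v' *m w'.
  apply/matrixP => i j; rewrite [LHS]mxE [RHS]mxE !big_ord1 !mxE.
  have := v0 i 0; rewrite le_eqVlt => /orP[/eqP <-|vi].
    by rewrite ltxx !mul0r.
  have := w0 0 j; rewrite le_eqVlt => /orP[/eqP <-|wj].
    by rewrite ltxx !mulr0.
  by rewrite (penalized_optimal_binary d_gt0 leEd nopt vi wj) vi wj mulr1.
have le' i j : v' i 0 * w' 0 j <= biadj R E i j.
  rewrite !mxE; case: (ltP 0 (v i 0)) => vi; last first.
    by rewrite mul0r; case: ifP.
  case: (ltP 0 (w 0 j)) => wj; last by rewrite mulr0; case: ifP.
  by rewrite (support_in_edges d_gt0 leEd nopt vi wj) mulr1.
split.
- move=> i j; rewrite vw mxE big_ord1.
  case: (bv' i 0) => ->; first by rewrite mul0r; left.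
  by rewrite mul1r; apply: bw'.
- by move=> i j; rewrite vw mxE big_ord1.
exists v', w'; split=> //; split=> // v2 w2 [bv2 bw2 le2].
(* Both (MBP) errors are penalized errors shifted by one constant, and binary competitors are
   feasible for (NF-1d), so optimality of [(v, w)] decides. *)
rewrite !(rank1_error_biadj d) // lerD2r.
have nonneg_binary p q (B : 'M[R]_(p, q)) : binary_mx B -> nonneg_mx B.
  by move=> bB i j; case: (bB i j) => ->.
have -> : rank1_error (penalized d (biadj R E)) v' w' =
    rank1_error (penalized d (biadj R E)) v w by rewrite /rank1_error vw.
by apply: opt; split; apply: nonneg_binary.
Qed.
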